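(* Consider the MPS model and its neural tangent kernel $K_D$ described in the context. For any two inputs $\mathbf{x}^{(i)},\mathbf{x}^{(j)}\in\mathbb{R}^n$, as the bond dimensions $D_1,\dots,D_n\to\infty$ sequentially, $$K_D(\mathbf{x}^{(i)},\mathbf{x}^{(j)})\xrightarrow{\text{Prob.}}\sum_{k=1}^n\phi_k(x^{(i)}_k)\cdot\phi_k(x^{(j)}_k)\prod_{l=1,\,l\neq k}^{n}\sigma_l^2\,\phi_l(x^{(i)}_l)\cdot\phi_l(x^{(j)}_l),$$ a deterministic (static) limit.
   Context: Fix $n\ge 1$, finite physical dimensions $d_1,\dots,d_n$, feature maps $\phi_i:\mathbb{R}\to\mathbb{R}^{d_i}$ with components $\phi_i^{s}$, and constants $\sigma_1,\dots,\sigma_n>0$; $\cdot$ is the Euclidean inner product. For bond dimensions $D_1,\dots,D_n$ put $D_{n+1}=D_1$. The MPS parameters are tensors $A^{(i)}_{s;a,b}$, $s\le d_i$, $a\le D_i$, $b\le D_{i+1}$, initialized with all entries independent, $A^{(i)}_{s;a,b}\sim\mathcal{N}(0,\sigma_i^2/\sqrt{D_iD_{i+1}})$. The MPS output is $\Psi(\mathbf{x})=\sum_{s_1,\dots,s_n}\sum_{a_1,\dots,a_n}A^{(1)}_{s_1;a_1a_2}\cdots A^{(n)}_{s_n;a_na_1}\prod_{i=1}^n\phi_i^{s_i}(x_i)$ for $\mathbf{x}=(x_1,\dots,x_n)$. With learning rates $\eta_k=(D_kD_{k+1})^{-1/2}$, the neural tangent kernel (NTK) of the MPS is $$K_D(\mathbf{x},\mathbf{x}')=\sum_{k=1}^n\eta_k\sum_{s\le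 d_k}\sum_{a\le D_k}\sum_{b\le D_{k+1}}\frac{\partial\Psi(\mathbf{x})}{\partial A^{(k)}_{s;a,b}}\,\frac{\partial\Psi(\mathbf{x}')}{\partial A^{(k)}_{s;a,b}},$$ evaluated at the random initialization. ''Sequentially'' means iterated limits, the bond dimensions being sent to infinity one after another. *)

(* Defs.v *)
From HB Require Import structures.
From mathcomp Require Import all_boot all_order all_algebra.
From mathcomp Require Import all_classical all_reals all_analysis.
Set Implicit Arguments. Unset Strict Implicit. Unset Printing Implicit Defensive.
Import Order.TTheory GRing.Theory Num.Theory.
Local Open Scope classical_set_scope.
Local Open Scope ring_scope.

Section MPS.
Variable R : realType.
Variable n : nat.
(* physical dimensions d_k and bond dimensions D_k, sites indexed by 'I_n
   (0-based); the cyclic successor ordS k plays the role of k+1, so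
   D (ordS (n-1)) = D 0, i.e. D_{n+1} = D_1. *)
Variable d : 'I_n -> nat.

Definition mps_idx (D : 'I_n -> nat) : finType :=
  {k : 'I_n & ('I_(d k) * 'I_(D k) * 'I_(D (ordS k)))%type}.

Definition entry (D : 'I_n -> nat) (k : 'I_n) (s : 'I_(d k)) (a : 'I_(D k))
  (b : 'I_(D (ordS k))) : mps_idx D := Tagged _ (s, a, b).

Definition mps_out (D : 'I_n -> nat) (phi : forall k : 'I_n, R -> 'I_(d k) -> R)
  (A : mps_idx D -> R) (x : 'I_n -> R) : R :=
  \sum_(s : {dffun forall k : 'I_n, 'I_(d k)})
  \sum_(a : {dffun forall k : 'I_n, 'I_(D k)})
    (\prod_(k : 'I_n) A (entry (s k) (a k) (a (ordS k)))) *
    \prod_(k : 'I_n) phi k (x k) (s k).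

Definition upd (D : 'I_n -> nat) (A : mps_idx D -> R) (i : mps_idx D) (t : R)
  : mps_idx D -> R := fun j => if j == i then t else A j.

Definition dmps (D : 'I_n -> nat) (phi : forall k : 'I_n, R -> 'I_(d k) -> R)
  (A : mps_idx D -> R) (x : 'I_n -> R) (i : mps_idx D) : R :=
  derive1 (fun t : R => mps_out phi (upd A i t) x) (A i).

Definition eta (D : 'I_n -> nat) (k : 'I_n) : R :=
  (Num.sqrt (((D k) * (D (ordS k)))%N%:R))^-1.

Definition ntk (D : 'I_n -> nat) (phi : forall k : 'I_n, R -> 'I_(d k) -> R)
  (A : mps_idx D -> R) (x x' : 'I_n -> R) : R :=
  \sum_(i : mps_idx D) eta D (tag i) * dmps phi A x i * dmps phi A x' i.

Definition fdot (phi : forall k : 'I_n, R -> 'I_(d k) -> R) (k : 'I_n) (y y' : R) : R :=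
  \sum_(s : 'I_(d k)) phi k y s * phi k y' s.

Definition ntk_limit (phi : forall k : 'I_n, R -> 'I_(d k) -> R) (sigma : 'I_n -> R)
  (x x' : 'I_n -> R) : R :=
  \sum_(k : 'I_n) fdot phi k (x k) (x' k) *
     \prod_(l : 'I_n | l != k) (sigma l ^+ 2 * fdot phi l (x l) (x' l)).

End MPS.

Definition setdim (n : nat) (D : 'I_n -> nat) (l : 'I_n) (N : nat) : 'I_n -> nat :=
  fun j => if j == l then N else D j.

(* Sequential (iterated) upper limit: for the order s = [:: l1; l2; ...],
   first D_{l1} -> oo, then D_{l2} -> oo, ... (limsup at each stage). *)
Fixpoint seq_limsup {R : realType} (n : nat) (s : seq 'I_n)
  (f : ('I_n -> nat) -> R) : ('I_n -> nat) -> R :=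
  match s with
  | [::] => f
  | l :: s' => seq_limsup s' (fun D => limn_sup (fun N : nat => f (setdim D l N)))
  end.

Definition mutually_independent {R : realType} d (T : measurableType d)
  (P : probability T R) (I : finType) (X : I -> T -> R) : Prop :=
  forall B : I -> set R, (forall i, measurable (B i)) ->
    P (\bigcap_(i in [set: I]) (X i @^-1` B i)) =
    (\prod_(i : I) P (X i @^-1` B i))%E.

Definition centered_gaussian {R : realType} d (T : measurableType d)
  (P : probability T R) (X : T -> R) (v : R) : Prop :=
  measurable_fun [set: T] X /\
  forall B : set R, measurable B -> P (X @^-1` B) = normal_prob 0 (Num.sqrt v) B.

(* Main.v *)
Require Import Defs.
From HB Require Import structures.
From mathcomp Require Import all_boot all_order all_algebra.
From mathcomp Require Import all_classical all_reals all_analysis.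
From mathcomp Require Import perm measurable_realfun ring lra.
Import Order.TTheory GRing.Theory Num.Theory numFieldNormedType.Exports.
Local Open Scope classical_set_scope.
Local Open Scope ring_scope.
Set Implicit Arguments.
Unset Strict Implicit.
Unset Printing Implicit Defensive.

(** The derivative of the network output in an entry of the site [k] is the
    network with the tensor at [k] replaced by a delta, so the kernel is
    [\sum_k eta_k Y_k], where [Y_k] contracts two copies of the network that
    are glued together at the site [k].  By independence and Wick's formula the
    mean of [eta_k Y_k] is exact: at every site the two copies must match, the
    bond sums give [\prod_l D_l], and the variances times the learning rate
    give [\prod_l D_l^-1].  In the second moment four copies occur, and Wick's
    formula turns it into a sum over the assignments of one of the three
    pairings of the copies to each site, the site [k] carrying 12|34.  Each bond
    contributes [1] if its two sites carry the same pairing and [1 / D_l]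
    otherwise, so the constant assignment gives the square of the mean and every
    other one is at most a constant times [\sum_l 1 / D_l].  Chebyshev's
    inequality then bounds the deviation probability by [C \sum_l 1 / D_l], and
    the successive upper limits remove the terms of this sum one at a time, in
    whatever order. *)

(** * Expectations and independence *)

Section Density.
Local Open Scope ereal_scope.
Context d (T : measurableType d) {R : realType}.

Lemma ge0_integral_density (mu : {sigma_finite_measure set T -> \bar R})
    (nu : {finite_measure set T -> \bar R}) (p : T -> R) :
  mu.-integrable setT (EFin \o p) ->
  (forall A, measurable A -> nu A = \int[mu]_(x in A) (p x)%:E) ->
  forall f : T -> \bar R, measurable_fun setT f -> (forall x, 0 <= f x) ->
  \int[nu]_x f x = \int[mu]_x (f x * (p x)%:E).
Proof.
move=> ip nuE f mf f_ge0.
have mp : measurable_fun setT (EFin \o p) by exact: measurable_int ip.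
have numu : nu `<< mu.
  apply/null_content_dominatesP => A mA muA.
  by rewrite nuE// null_set_integral//; exact: measurable_funTS.
have iD : mu.-integrable setT (Radon_Nikodym_SigmaFinite.f nu mu).
  exact: Radon_Nikodym_SigmaFinite.f_integrable.
rewrite -(Radon_Nikodym_SigmaFinite.change_of_variables numu)//.
apply: ae_eq_integral => //.
- by apply: emeasurable_funM => //; exact: measurable_int iD.
- exact: emeasurable_funM.
- apply: ae_eqe_mul2l; apply: integral_ae_eq => // A _ mA.
  by rewrite -Radon_Nikodym_SigmaFinite.f_integral// nuE.
Qed.

Definition density_measure (mu : {measure set T -> \bar R}) (p : T -> R)
    & mu.-integrable setT (EFin \o p) & (forall x, (0 <= p x)%R) :=
  fun A : set T => \int[mu]_(x in A) (p x)%:E.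

Section density_measure_instances.
Variables (mu : {measure set T -> \bar R}) (p : T -> R).
Hypotheses (ip : mu.-integrable setT (EFin \o p))
  (p_ge0 : forall x, (0 <= p x)%R).
Local Notation nu := (density_measure ip p_ge0).

Let nu_set0 : nu set0 = 0. Proof. exact: integral_set0. Qed.

Let nu_ge0 A : 0 <= nu A.
Proof. by apply: integral_ge0 => x _; rewrite lee_fin. Qed.

Let nu_sigma_additive : semi_sigma_additive nu.
Proof.
apply: semi_sigma_additive_nng_induced; first exact: measurable_int ip.
by move=> x; rewrite lee_fin.
Qed.

HB.instance Definition _ :=
  isMeasure.Build _ _ _ nu nu_set0 nu_ge0 nu_sigma_additive.

Let nu_finite : fin_num_fun nu.
Proof.
by move=> A mA; apply: integrable_fin_num => //; exact: integrableS ip.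
Qed.

HB.instance Definition _ := Measure_isFinite.Build _ _ _ nu nu_finite.

End density_measure_instances.

End Density.

Section Expectation.
Context {dT : measure_display} {T : measurableType dT} {R : realType}.
Variable P : probability T R.
Implicit Types (f g : T -> R) (u v c : R).

Definition has_expectation f v : Prop :=
  P.-integrable setT (EFin \o f) /\ ('E_P[f] = v%:E)%E.

Lemma has_expectation_eq f g u v :
  f =1 g -> u = v -> has_expectation f u -> has_expectation g v.
Proof. by move=> /funext -> ->. Qed.

Lemma has_expectation_measurable f v :
  has_expectation f v -> measurable_fun setT f.
Proof. by case=> /measurable_int /measurable_EFinP. Qed.

Lemma has_expectation_unique f u v :
  has_expectation f u -> has_expectation f v -> u = v.
Proof. by move=> [_ fu] [_]; rewrite fu => -[]. Qed.

Lemma integrable_has_expectation f :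
  P.-integrable setT (EFin \o f) -> exists v, has_expectation f v.
Proof.
move=> fi; exists (fine 'E_P[f]); split => //.
by rewrite fineK// unlock; exact: integrable_fin_num.
Qed.

Lemma ge0_has_expectation f v :
  (forall w, 0 <= f w) -> measurable_fun setT f ->
  (\int[P]_w (f w)%:E = v%:E)%E -> has_expectation f v.
Proof.
move=> f_ge0 mf fv; split; last by rewrite unlock.
apply/integrableP; split; first exact/measurable_EFinP.
by under eq_integral do rewrite /= ger0_norm//; rewrite fv ltry.
Qed.

Lemma has_expectation_cst c : has_expectation (cst c) c.
Proof.
by split; [exact: finite_measure_integrable_cst | exact: expectation_cst].
Qed.

Lemma has_expectationZ c f v :
  has_expectation f v -> has_expectation (fun w => c * f w) (c * v).
Proof.
move=> [fi]; rewrite unlock => fv; split; first exact: (integrableZl _ c fi).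
by rewrite unlock; under eq_integral do rewrite EFinM; rewrite integralZl// fv.
Qed.

Lemma has_expectationD f g u v : has_expectation f u -> has_expectation g v ->
  has_expectation (fun w => f w + g w) (u + v).
Proof.
move=> [fi fu] [gi gv]; split; first exact: (integrableD _ fi gi).
by rewrite (expectationD (X := f) (Y := g)) ?fu ?gv//; exact/Lfun1_integrable.
Qed.

Lemma has_expectation_sum (I : Type) (r : seq I) (Q : pred I)
    (f : I -> T -> R) (v : I -> R) :
  (forall i, Q i -> has_expectation (f i) (v i)) ->
  has_expectation (fun w => \sum_(i <- r | Q i) f i w)
                  (\sum_(i <- r | Q i) v i).
Proof.
move=> fv; elim: r => [|i r ih].
  rewrite big_nil; apply: has_expectation_eq (has_expectation_cst 0) => // w.
  by rewrite big_nil.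
rewrite big_cons; case: ifPn => Qi; last first.
  by apply: has_expectation_eq ih => // w; rewrite big_cons (negbTE Qi).
apply: has_expectation_eq (has_expectationD (fv i Qi) ih) => // w.
by rewrite big_cons Qi.
Qed.

Lemma le_has_expectation f g u v : has_expectation f u -> has_expectation g v ->
  (forall w, f w <= g w) -> u <= v.
Proof.
move=> [fi]; rewrite unlock => fu [gi]; rewrite unlock => gv fg.
by rewrite -lee_fin -fu -gv; apply: le_integral => // w _; rewrite lee_fin.
Qed.

Lemma has_expectation_indic (A : set T) : measurable A ->
  has_expectation \1_A (fine (P A)).
Proof.
move=> mA; apply: ge0_has_expectation => //.
by rewrite integral_indic// setIT fineK// fin_num_measure.
Qed.

Lemma fine_probability_itv01 (A : set T) : measurable A -> 0 <= fine (P A) <= 1.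
Proof.
move=> mA; rewrite fine_ge0 ?measure_ge0//=.
by rewrite -lee_fin fineK ?fin_num_measure//; exact: probability_le1.
Qed.

Lemma measurable_tail f eps : measurable_fun setT f ->
  measurable [set w | eps < `|f w|].
Proof.
move=> mf; rewrite -[X in measurable X]setTI; apply: measurable_fun_ltr => //.
exact: measurableT_comp.
Qed.

Lemma second_moment_tail_bound f g v eps : measurable_fun setT f ->
  (forall w, f w ^+ 2 <= g w) -> has_expectation g v -> 0 < eps ->
  fine (P [set w | eps < `|f w|]) <= eps ^- 2 * v.
Proof.
move=> mf f2_le_g gv eps_gt0; set E := [set w | _].
have mE : measurable E by exact: measurable_tail.
rewrite ler_pdivlMl ?exprn_gt0//.
have Eeps2 := has_expectationZ (eps ^+ 2) (has_expectation_indic mE).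
apply: le_has_expectation Eeps2 gv _ => w.
apply: le_trans (f2_le_g w); rewrite indicE.
have [|_] := boolP (w \in E); last by rewrite mulr0 sqr_ge0.
rewrite inE mulr1 -(real_normK (num_real (f w))) => /ltW.
by rewrite ler_pXn2r// nnegrE ltW.
Qed.

End Expectation.

Lemma has_expectation_law d d' (T : measurableType d) (S : measurableType d')
    (R : realType) (P : probability T R) (Q : probability S R) (X : T -> S) :
  measurable_fun setT X ->
  (forall B, measurable B -> P (X @^-1` B) = Q B) ->
  forall g v, has_expectation Q g v -> has_expectation P (g \o X) v.
Proof.
move=> mX PXQ g v gv; have mg := has_expectation_measurable gv.
have meg : measurable_fun setT (EFin \o g) by exact/measurable_EFinP.
case: gv => /integrableP[_ gi]; rewrite unlock => gv.
have iX : P.-integrable setT (EFin \o (g \o X)).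
  apply/integrableP; split; first exact: (measurableT_comp meg).
  have mabs : measurable_fun setT (abse \o (EFin \o g)).
    exact: measurableT_comp.
  rewrite -[ltLHS](ge0_integral_pushforward mX P measurableT mabs); last first.
    by move=> y _ /=.
  by rewrite (eq_measure_integral Q)// => B mB _; exact: PXQ.
split => //; rewrite unlock -gv.
rewrite -[LHS](integral_pushforward mX meg _ measurableT)//.
by apply: eq_measure_integral => B mB _; exact: PXQ.
Qed.

Lemma antisymmetric_has_expectation d (T : measurableType d) (R : realType)
    (P : probability T R) (tau : T -> T) (f : T -> R) :
  measurable_fun setT tau ->
  (forall B, measurable B -> P (tau @^-1` B) = P B) ->
  (forall w, f (tau w) = - f w) ->
  P.-integrable setT (EFin \o f) -> has_expectation P f 0.
Proof.
move=> mtau Ptau ftau /integrable_has_expectation[v fv].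
suff <- : v = 0 by [].
have : has_expectation P (f \o tau) (- 1 * v).
  apply: has_expectation_eq (has_expectationZ (- 1) fv) => // w /=.
  by rewrite ftau mulN1r.
move=> /(has_expectation_unique (has_expectation_law mtau Ptau fv)).
lra.
Qed.

(* The push-forwards under [X] of [P] and of the measure with density [W]
   are proportional, so [W] factors out of every expectation of [g \o X]. *)
Lemma ge0_expectation_factor d d' (T : measurableType d) (S : measurableType d')
    (R : realType) (P : probability T R) (X : T -> S) (W : T -> R) (c : R) :
  measurable_fun setT X -> (forall w, 0 <= W w) ->
  (forall B, measurable B -> has_expectation P (fun w => \1_B (X w) * W w)
                                               (fine (P (X @^-1` B)) * c)) ->
  forall (g : S -> R) v, measurable_fun setT g -> (forall y, 0 <= g y) ->
  has_expectation P (g \o X) v ->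
  has_expectation P (fun w => g (X w) * W w) (v * c).
Proof.
move=> mX W_ge0 XW g v mg g_ge0 gv.
have meg : measurable_fun setT (EFin \o g) by exact/measurable_EFinP.
have eg_ge0 : {in setT, forall y, (0 <= (EFin \o g) y)%E}.
  by move=> y _; rewrite lee_fin.
have W_mean : has_expectation P W c.
  apply: has_expectation_eq (XW setT measurableT) => [w|].
    by rewrite indicT mul1r.
  by rewrite preimage_setT probability_setT mul1r.
have c_ge0 : 0 <= c.
  exact: le_has_expectation (has_expectation_cst P 0) W_mean _.
apply: ge0_has_expectation => [w||]; first by rewrite mulr_ge0.
  apply: measurable_funM; first exact: measurableT_comp.
  exact: has_expectation_measurable W_mean.
have W_int := W_mean.1; pose nu := density_measure W_int W_ge0.
case: gv => _; rewrite unlock mulrC EFinM => <-.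
under eq_integral do rewrite EFinM.
rewrite -(ge0_integral_density (nu := nu) W_int)//; last 2 first.
- exact: (measurableT_comp meg).
- by move=> w; rewrite lee_fin.
rewrite -[LHS](ge0_integral_pushforward mX nu measurableT meg eg_ge0).
rewrite -[in RHS](ge0_integral_pushforward mX P measurableT meg eg_ge0).
rewrite -(ge0_integral_mscale (pushforward P X) measurableT (NngNum c_ge0) meg);
  last by move=> y _; rewrite lee_fin.
apply: eq_measure_integral => B mB _.
have mXB : measurable (X @^-1` B) by rewrite -[_ @^-1` _]setTI; exact: mX.
have [_] := XW B mB; rewrite unlock [(_ * c)%R]mulrC EFinM.
rewrite fineK ?fin_num_measure//.
move=> WB; rewrite -[RHS]WB [LHS]integral_mkcond.
apply: eq_integral => w _; rewrite patchE indicE -[X w \in B]/(w \in X @^-1` B).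
by case: ifPn; rewrite ?mul1r ?mul0r.
Qed.

Section IndependentProduct.
Context {dT : measure_display} {T : measurableType dT} {R : realType}.
Variables (P : probability T R) (I : finType) (X : I -> T -> R).
Hypotheses (mX : forall i, measurable_fun setT (X i))
  (indep : mutually_independent P X).

Let measurable_preimX i (B : set R) : measurable B -> measurable (X i @^-1` B).
Proof. by move=> mB; rewrite -[X in measurable X]setTI; exact: mX. Qed.

Let expectation_indic_preimX i (B : set R) : measurable B ->
  has_expectation P (\1_B \o X i) (fine (P (X i @^-1` B))).
Proof. by move=> mB; exact/has_expectation_indic/measurable_preimX. Qed.

Lemma expectation_prod_indic (B : I -> set R) :
  (forall i, measurable (B i)) ->
  has_expectation P (fun w => \prod_i \1_(B i) (X i w))
                    (\prod_i fine (P (X i @^-1` B i))).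
Proof.
move=> mB.
have mXB : measurable (\bigcap_(i in [set: I]) (X i @^-1` B i)).
  apply: fin_bigcap_measurable => [|i _]; last exact: measurable_preimX.
  exact: finite_finset.
apply: has_expectation_eq (has_expectation_indic P mXB) => [w|].
  rewrite indicE; have [|] := boolP (w \in _).
    rewrite inE => wB; rewrite big1// => i _.
    by rewrite indicE mem_set//; exact: wB.
  rewrite notin_setE => /existsNP[i /not_implyP[_ wi]].
  by rewrite (bigD1 i)//= indicE memNset ?mul0r.
rewrite indep// (eq_bigr (fun i => (fine (P (X i @^-1` B i)))%:E)).
  by rewrite prodEFin.
by move=> i _; rewrite fineK// fin_num_measure//; exact: measurable_preimX.
Qed.

(* Induction on the set [s] of the factors that are not yet indicators. *)
Let ge0_expectation_prod_rec (s : seq I) (g : I -> R -> R) (m : I -> R) :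
  (forall i, measurable_fun setT (g i)) -> (forall i y, 0 <= g i y) ->
  (forall i, has_expectation P (g i \o X i) (m i)) ->
  (forall i, i \notin s -> exists2 B, measurable B & g i = \1_B) ->
  has_expectation P (fun w => \prod_i g i (X i w)) (\prod_i m i).
Proof.
elim: s g m => [|i s ih] g m mg g_ge0 gm gB.
  have /choice[B BP] : forall i, exists B, measurable B /\ g i = \1_B.
    by move=> i; have [//|B] := gB i; exists B.
  have mB i : measurable (B i) by have [] := BP i.
  apply: has_expectation_eq (expectation_prod_indic mB) => [w|].
    by apply: eq_bigr => i _; have [_ ->] := BP i.
  apply: eq_bigr => i _; apply: has_expectation_unique (gm i).
  by have [_ ->] := BP i; exact: expectation_indic_preimX.
pose W w := \prod_(j | j != i) g j (X j w).
pose c := \prod_(j | j != i) m j.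
have indicW B : measurable B ->
    has_expectation P (fun w => \1_B (X i w) * W w)
                      (fine (P (X i @^-1` B)) * c).
  move=> mB; pose g_i := dfwith g i \1_B.
  pose m_i := dfwith m i (fine (P (X i @^-1` B))).
  have prod_g_i :
      has_expectation P (fun w => \prod_j g_i j (X j w)) (\prod_j m_i j).
    apply: ih => [j|j y|j|j js]; rewrite /g_i /m_i.
    - by case: dfwithP.
    - by case: dfwithP.
    - have [<-|ij] := eqVneq i j; last by rewrite !dfwithout.
      by rewrite !dfwithin; exact: expectation_indic_preimX.
    - have [<-|ij] := eqVneq i j; first by rewrite dfwithin; exists B.
      by rewrite dfwithout//; apply: gB; rewrite inE negb_or eq_sym ij.
  apply: has_expectation_eq prod_g_i => [w|];
      rewrite (bigD1 i)//= /g_i /m_i dfwithin.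
    by congr (_ * _); apply: eq_bigr => j ji; rewrite dfwithout// eq_sym.
  by congr (_ * _); apply: eq_bigr => j ji; rewrite dfwithout// eq_sym.
have W_ge0 w : 0 <= W w by exact: prodr_ge0.
apply: has_expectation_eq
  (ge0_expectation_factor (mX i) W_ge0 indicW (mg i) (g_ge0 i) (gm i)) => [w|].
- by rewrite [RHS](bigD1 i).
- by rewrite [RHS](bigD1 i).
Qed.

Let ge0_expectation_prod (g : I -> R -> R) (m : I -> R) :
  (forall i, measurable_fun setT (g i)) -> (forall i y, 0 <= g i y) ->
  (forall i, has_expectation P (g i \o X i) (m i)) ->
  has_expectation P (fun w => \prod_i g i (X i w)) (\prod_i m i).
Proof.
move=> mg g_ge0 gm; apply: (@ge0_expectation_prod_rec (enum I)) => // i.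
by rewrite mem_enum.
Qed.

Let signed_part (b : bool) (f : R -> R) : R -> R := if b then f^\- else f^\+.

Let sum_signed_part f y : f y = \sum_(b : bool) (-1) ^+ b * signed_part b f y.
Proof.
by rewrite big_bool /= expr1 expr0 mul1r mulN1r addrC -[in LHS](funrposBneg f).
Qed.

Lemma expectation_prod (g : I -> R -> R) (m : I -> R) :
  (forall i, measurable_fun setT (g i)) ->
  (forall i, has_expectation P (g i \o X i) (m i)) ->
  has_expectation P (fun w => \prod_i g i (X i w)) (\prod_i m i).
Proof.
move=> mg gm.
have /choice[mu muP] : forall bi : bool * I, exists v,
    has_expectation P (signed_part bi.1 (g bi.2) \o X bi.2) v.
  move=> [b i]; apply: integrable_has_expectation; have [gi _] := gm i.
  by case: b; [exact: (integrable_funrneg (f := g i \o X i))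
              |exact: (integrable_funrpos (f := g i \o X i))].
have mE i : m i = \sum_(b : bool) (-1) ^+ b * mu (b, i).
  apply: has_expectation_unique (gm i) _.
  apply: has_expectation_eq (has_expectation_sum _ (fun (b : bool) _ =>
    has_expectationZ ((-1) ^+ b) (muP (b, i)))) => // w.
  by rewrite [RHS]sum_signed_part.
rewrite (eq_bigr _ (fun i _ => mE i)) bigA_distr_bigA/=.
have prod_part (f : {ffun I -> bool}) : has_expectation P
    (fun w => \prod_i ((-1) ^+ f i * signed_part (f i) (g i) (X i w)))
    (\prod_i ((-1) ^+ f i * mu (f i, i))).
  apply: has_expectation_eq (has_expectationZ (\prod_i (-1) ^+ f i)
    (ge0_expectation_prod (g := fun i => signed_part (f i) (g i)) _ _
      (fun i => muP (f i, i)))) => [w|||].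
  - by rewrite big_split.
  - by rewrite big_split.
  - by move=> i; case: (f i);
      [exact: measurable_funrneg|exact: measurable_funrpos].
  - by move=> i y; rewrite /signed_part; case: (f i);
      rewrite ?funrneg_ge0 ?funrpos_ge0.
have sum_part := has_expectation_sum (index_enum {ffun I -> bool}) (Q := xpredT)
  (fun f _ => prod_part f).
apply: has_expectation_eq sum_part => // w.
by under [RHS]eq_bigr do rewrite sum_signed_part; rewrite bigA_distr_bigA.
Qed.

End IndependentProduct.

(** * Gaussian moments *)

Fixpoint gauss_moment {R : pzRingType} (v : R) (e : nat) : R :=
  if e is e'.+2 then e'.+1%:R * v * gauss_moment v e' else (e == 0)%:R.

Lemma gauss_momentS (R : pzRingType) (v : R) e :
  gauss_moment v e.+1 = e%:R * v * gauss_moment v e.-1.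
Proof. by case: e => [|e] //=; rewrite !mul0r. Qed.

Lemma gauss_moment_odd (R : pzRingType) (v : R) e :
  odd e -> gauss_moment v e = 0.
Proof.
elim/ltn_ind: e => -[|[|e]] //= ih; rewrite negbK => oe.
by rewrite ih ?mulr0.
Qed.

Lemma pow_expRN_le (R : realType) m (y : R) : 0 <= y ->
  y ^+ m * expR (- y) <= m`!%:R.
Proof.
move=> y_ge0; rewrite expRN ler_pdivrMr ?expR_gt0//.
case: m => [|m]; first by rewrite expr0 fact0 mul1r -expR0 ler_expR.
rewrite mulrC -ler_pdivrMr ?ltr0n ?fact_gt0//.
by apply: le_trans (expR_ge1Dxn m y_ge0); rewrite lerDr.
Qed.

Lemma derivable_oo_LRcontinuousT (R : realType) (f : R -> R) (a b : R) :
  (forall x, derivable f x 1) -> derivable_oo_LRcontinuous f a b.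
Proof.
move=> df.
have cf : continuous f.
  by move=> x; exact/differentiable_continuous/derivable1_diffP.
by split=> [x _||]; [|apply: cvg_at_right_filter|apply: cvg_at_left_filter];
  [exact: df|exact: cf..].
Qed.

Section NormalMoments.
Context {R : realType}.
Variable s : R.
Hypothesis s_gt0 : 0 < s.
Notation mu := (@lebesgue_measure R).
Notation p := (normal_pdf 0 s).

Let s_neq0 : s != 0. Proof. by rewrite gt_eqF. Qed.

Lemma centered_normal_pdfE x :
  p x = normal_peak s * expR (- x ^+ 2 / (s ^+ 2 *+ 2)).
Proof. by rewrite normal_pdfE// /normal_fun subr0. Qed.

Lemma centered_normal_pdfN x : p (- x) = p x.
Proof. by rewrite !centered_normal_pdfE sqrrN. Qed.

Lemma is_derive_centered_normal_pdf x :
  is_derive x (1:R) p (- (x / s ^+ 2) * p x).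
Proof.
have -> : p = (fun x => normal_peak s * expR (- (s ^+ 2 *+ 2)^-1 * x ^+ 2)).
  by apply/funext => y; rewrite centered_normal_pdfE !mulNr (mulrC (y ^+ 2)).
by apply: is_derive_eq; rewrite /GRing.scale/=; field.
Qed.

Let continuous_pow_pdf j : continuous (fun x : R => x ^+ j * p x).
Proof.
move=> x; apply: cvgM; first exact: exprn_continuous.
exact: continuous_normal_pdf.
Qed.

Lemma pow_centered_normal_pdf_le m x :
  x ^+ (2 * m) * p x <= normal_peak s * (s ^+ 2 *+ 2) ^+ m * m`!%:R.
Proof.
have s2_gt0 : 0 < s ^+ 2 *+ 2 by rewrite mulrn_wgt0// exprn_gt0.
have y_ge0 : 0 <= x ^+ 2 / (s ^+ 2 *+ 2) by rewrite divr_ge0 ?sqr_ge0// ltW.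
have -> : x ^+ (2 * m) * p x = normal_peak s * (s ^+ 2 *+ 2) ^+ m *
    ((x ^+ 2 / (s ^+ 2 *+ 2)) ^+ m * expR (- (x ^+ 2 / (s ^+ 2 *+ 2)))).
  rewrite centered_normal_pdfE mulNr exprM expr_div_n.
  by field; rewrite expf_neq0// gt_eqF.
apply: ler_wpM2l (pow_expRN_le m y_ge0).
by rewrite mulr_ge0 ?normal_peak_ge0// exprn_ge0// ltW.
Qed.

Lemma pow_centered_normal_pdf_cvg0 k :
  ((n%:R : R) ^+ k * p n%:R) @[n --> \oo] --> (0 : R).
Proof.
pose C := normal_peak s * (s ^+ 2 *+ 2) ^+ k.+1 * (k.+1)`!%:R.
have cC : (C / n.+1%:R) @[n --> \oo] --> (0 : R).
  by rewrite -(mulr0 C); apply: cvgMl_tmp; exact: cvg_harmonic.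
rewrite -cvg_shiftS/=; apply: (squeeze_cvgr _ (cvg_cst 0) cC).
near=> n; have n_gt0 : 0 < n.+1%:R :> R by rewrite ltr0n.
rewrite mulr_ge0 ?exprn_ge0 ?normal_pdf_ge0//=.
rewrite ler_pdivlMr// mulrAC -exprSr.
apply: le_trans (pow_centered_normal_pdf_le k.+1 n.+1%:R).
rewrite ler_wpM2r ?normal_pdf_ge0// ler_weXn2l ?ler1n//.
by rewrite mul2n -addnn leq_addr.
Unshelve. all: by end_near. Qed.

Let half_moment j := (\int[mu]_(x in `[0%R, +oo[) (x ^+ j * p x)%:E)%E.

Let integrable_pow_pdf j (n : nat) :
  mu.-integrable `[0, n%:R] (EFin \o (fun x : R => x ^+ j * p x)).
Proof.
apply: continuous_compact_integrable; first exact: segment_compact.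
by apply: continuous_subspaceT => x; exact: continuous_pow_pdf.
Qed.

(* Integration by parts with [- s ^+ 2 * p] as a primitive of [x * p]. *)
Let pow_pdf_by_parts j (n : nat) : (0 < n)%N ->
  (\int[mu]_(x in `[0%R, n%:R]) (x ^+ j.+2 * p x)%:E =
   (j.+1%:R * s ^+ 2)%:E * \int[mu]_(x in `[0%R, n%:R]) (x ^+ j * p x)%:E
   - (s ^+ 2 * (n%:R ^+ j.+1 * p n%:R))%:E)%E.
Proof.
move=> n_gt0; pose G x := - s ^+ 2 * p x.
have dG (x : R) : is_derive x (1:R) G (x * p x).
  have dp := is_derive_centered_normal_pdf x.
  by apply: is_derive_eq; rewrite /GRing.scale/=; field.
have := @integration_by_parts R (fun x => x ^+ j.+1) G
  (fun x => j.+1%:R * x ^+ j) (fun x => x * p x) 0 n%:R.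
rewrite ltr0n => parts.
under eq_integral do rewrite exprSr -mulrA.
rewrite {}parts//.
- under [X in (_ - X)%E]eq_integral => x _.
    rewrite (_ : _ * G x = - (j.+1%:R * s ^+ 2) * (x ^+ j * p x)).
      by rewrite EFinM; over.
    by rewrite /G; ring.
  rewrite integralZl//=; last exact: integrable_pow_pdf.
  rewrite EFinN mulNe oppeK addeC expr0n mul0r subr0; congr (_ + _)%E.
  by congr EFin; rewrite /G; ring.
- apply: continuous_subspaceT => x; apply: cvgMl_tmp.
  exact: exprn_continuous.
- by apply: derivable_oo_LRcontinuousT => x; exact: exprn_derivable.
- by move=> x _; rewrite exp_derive1.
- apply: continuous_subspaceT => x; have := @continuous_pow_pdf 1 x.
  by under eq_fun do rewrite expr1.
- by apply: derivable_oo_LRcontinuousT => x; exact: ex_derive.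
- by move=> x _; rewrite derive1E; exact: derive_val.
Qed.

Let half_momentS j c : ~~ odd j -> half_moment j = c%:E ->
  half_moment j.+2 = (j.+1%:R * s ^+ 2 * c)%:E.
Proof.
move=> oj jc.
have half_moment_cvg k : ~~ odd k ->
    (\int[mu]_(x in `[0%R, n%:R]) (x ^+ k * p x)%:E)%E @[n --> \oo] -->
    half_moment k.
  move=> ok; apply: (@ge0_cvgn_integral _ mu (fun x : R => x ^+ k * p x)).
    by move=> x; rewrite mulr_ge0 ?normal_pdf_ge0 ?exprn_even_ge0.
  by apply: continuous_measurable_fun; exact: continuous_pow_pdf.
have := half_moment_cvg j.+2; rewrite /= negbK => /(_ oj) lim_j2.
have : ((j.+1%:R * s ^+ 2)%:E * \int[mu]_(x in `[0%R, n%:R]) (x ^+ j * p x)%:E -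
    (s ^+ 2 * (n%:R ^+ j.+1 * p n%:R))%:E)%E @[n --> \oo] -->
    ((j.+1%:R * s ^+ 2)%:E * c%:E - (s ^+ 2 * 0)%:E)%E.
  apply: cvgeB => //.
    by apply: cvgeZl => //; rewrite -jc; exact: half_moment_cvg.
  apply: cvg_EFin; first exact: nearW.
  by apply: cvgMl_tmp; exact: pow_centered_normal_pdf_cvg0.
rewrite mulr0 sube0 -EFinM => lim_parts.
apply: (cvg_unique _ lim_j2) => //; apply: cvg_trans lim_parts.
apply: near_eq_cvg; near=> n; rewrite pow_pdf_by_parts//.
by near: n; exact: nbhs_infty_gt.
Unshelve. all: by end_near. Qed.

Let integral_even j : ~~ odd j ->
  (\int[mu]_x (x ^+ j * p x)%:E = 2%:E * half_moment j)%E.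
Proof.
move=> oj; rewrite ge0_symfun_integralT//=.
- by rewrite -set_itvcy.
- by move=> x; rewrite mulr_ge0 ?normal_pdf_ge0 ?exprn_even_ge0.
- move=> x /=; rewrite centered_normal_pdfN exprNn -signr_odd (negbTE oj).
  by rewrite mul1r.
Qed.

Let half_moment0 : half_moment 0 = (2^-1)%:E.
Proof.
have := integral_even (isT : ~~ odd 0).
under eq_integral do rewrite expr0 mul1r.
rewrite integral_normal_pdf; case: (half_moment 0) => [r [r2]| |].
- by congr EFin; apply: (mulfI (_ : 2 != 0)) => //; rewrite -r2 divff.
- by rewrite mulry gtr0_sg// mul1e.
- by rewrite mulrNy gtr0_sg// mul1e.
Qed.

Let half_moment_double k :
  half_moment k.*2 = (2^-1 * gauss_moment (s ^+ 2) k.*2)%:E.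
Proof.
elim: k => [|k ih]; first by rewrite half_moment0 mulr1.
rewrite doubleS (half_momentS _ ih) ?odd_double//.
by congr EFin; rewrite [in RHS]/=; ring.
Qed.

Lemma even_normal_moment j : ~~ odd j ->
  has_expectation (normal_prob 0 s) (fun x => x ^+ j) (gauss_moment (s ^+ 2) j).
Proof.
move=> oj; have xj_ge0 (x : R) : 0 <= x ^+ j by exact: exprn_even_ge0.
have mxj : measurable_fun setT (fun x : R => x ^+ j) by exact: measurable_funX.
apply: ge0_has_expectation => //.
rewrite (ge0_integral_density (mu := mu) (p := p))//.
- under eq_integral do rewrite -EFinM.
  rewrite integral_even// -(even_halfK oj) half_moment_double -EFinM.
  by rewrite mulrA divff ?mul1r.
- exact: integrable_normal_pdf.
- exact/measurable_EFinP.
Qed.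

Lemma normal_prob_oppr (B : set R) : measurable B ->
  normal_prob 0 s (-%R @^-1` B) = normal_prob 0 s B.
Proof.
move=> mB; have mp : measurable_fun B (EFin \o p).
  by apply/measurable_EFinP/measurable_funTS; exact: measurable_normal_pdf.
have p_ge0 : {in B, forall x, (0 <= (EFin \o p) x)%E}.
  by move=> x _; rewrite lee_fin normal_pdf_ge0.
have := @ge0_integral_pushforward _ _ (measurableTypeR R) (measurableTypeR R) R
  -%R (@oppr_measurable R setT) mu B (EFin \o p) mB mp p_ge0.
under [in X in _ = X -> _]eq_integral do rewrite /= centered_normal_pdfN.
move=> pushE; rewrite /normal_prob -[LHS]pushE.
by apply: eq_measure_integral => C mC _; exact: lebesgue_measureN.
Qed.

Let integrable_odd_power j : odd j ->
  (normal_prob 0 s).-integrable setT (EFin \o (fun x => x ^+ j)).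
Proof.
move=> oj; have oj1 : ~~ odd j.+1 by rewrite /= oj.
have [dom _] :=
  has_expectationD (has_expectation_cst _ 1) (even_normal_moment oj1).
apply: le_integrable dom => // [|x _ /=].
  by apply/measurable_EFinP; exact: measurable_funX.
rewrite lee_fin normrX [leRHS]ger0_norm ?addr_ge0 ?exprn_even_ge0//.
rewrite -[x ^+ j.+1]ger0_norm ?exprn_even_ge0// normrX.
have [x1|/ltW x1] := leP `|x| 1.
  by rewrite (le_trans (exprn_ile1 _ _ x1))// lerDl exprn_ge0.
by rewrite (le_trans (ler_weXn2l x1 (leqnSn j)))// lerDr.
Qed.

Lemma odd_normal_moment j : odd j ->
  has_expectation (normal_prob 0 s) (fun x => x ^+ j) 0.
Proof.
move=> oj.
apply: (antisymmetric_has_expectation (P := normal_prob 0 s) (tau := -%R)).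
- exact: oppr_measurable.
- exact: normal_prob_oppr.
- by move=> x; rewrite exprNn -signr_odd oj expr1 mulN1r.
- exact: integrable_odd_power.
Qed.

Lemma normal_moment j :
  has_expectation (normal_prob 0 s) (fun x => x ^+ j) (gauss_moment (s ^+ 2) j).
Proof.
have [oj|] := boolP (odd j); last exact: even_normal_moment.
by rewrite gauss_moment_odd//; exact: odd_normal_moment.
Qed.

End NormalMoments.

Lemma centered_gaussian_moment (R : realType) (dT : measure_display)
    (T : measurableType dT) (P : probability T R) (X : T -> R) (v : R) e :
  0 < v -> centered_gaussian P X v ->
  has_expectation P (fun w => X w ^+ e) (gauss_moment v e).
Proof.
move=> v_gt0 [mX PX]; have s_gt0 : 0 < Num.sqrt v by rewrite sqrtr_gt0.
have := normal_moment s_gt0 e.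
move=> /(has_expectation_law (Q := normal_prob 0 (Num.sqrt v)) mX PX).
by rewrite sqr_sqrtr// ltW.
Qed.

(** * Cyclic contractions *)

Section DependentSums.
Variable R : comNzRingType.

Lemma bigA_distr_dffun (I : finType) (T_ : I -> finType)
    (F : forall i, T_ i -> R) :
  \prod_i \sum_(j : T_ i) F i j =
  \sum_(f : {dffun forall i, T_ i}) \prod_i F i (f i).
Proof.
pose F' i : {ffun T_ i -> R} := [ffun j => F i j].
rewrite (reindex (@dffun_of_fprod _ T_)); last exact/onW_bij/dffun_of_fprod_bij.
transitivity (\sum_(t : fprod T_) \prod_(i in I) F' i (t i)); last first.
  by apply: eq_bigr => t _; apply: eq_bigr => i _; rewrite !ffunE.
rewrite big_fprod -(bigA_distr_big_dep (fun i => tagged_with T_ i)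
  (fun i j => untag 0 (F' i) j)); apply: eq_bigr => i _.
rewrite -(big_tag (fun i => F' i) i).
by apply: eq_bigr => j _; rewrite ffunE.
Qed.

Lemma pair_big_dffun (I : finType) (X Y : I -> finType)
    (G : {dffun forall i, X i} -> {dffun forall i, Y i} -> R) :
  \sum_a \sum_b G a b =
  \sum_(c : {dffun forall i, (X i * Y i)%type})
    G [ffun i => (c i).1] [ffun i => (c i).2].
Proof.
rewrite pair_bigA/=.
pose unzip (c : {dffun forall i, (X i * Y i)%type}) :
    {dffun forall i, X i} * {dffun forall i, Y i} :=
  ([ffun i => (c i).1], [ffun i => (c i).2]).
pose zip (ab : {dffun forall i, X i} * {dffun forall i, Y i}) :
    {dffun forall i, (X i * Y i)%type} := [ffun i => (ab.1 i, ab.2 i)].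
rewrite (reindex unzip)//; exists zip => [c _|[a b] _].
  by apply/ffunP => i; rewrite !ffunE; case: (c i).
by congr pair; apply/ffunP => i; rewrite !ffunE.
Qed.

End DependentSums.

Lemma sum_diag (R : pzSemiRingType) (X : finType) (F : X * X -> R) :
  \sum_q F q * (q.1 == q.2)%:R = \sum_u F (u, u).
Proof.
transitivity (\sum_a \sum_b F (a, b) * (a == b)%:R).
  by rewrite pair_bigA; apply: eq_bigr => -[].
apply: eq_bigr => a _; rewrite (bigD1 a)//= eqxx mulr1 big1 ?addr0// => b.
by rewrite eq_sym => /negbTE ->; rewrite mulr0.
Qed.

Lemma sqr_sum_le (R : realFieldType) (I : finType) (y : I -> R) :
  (\sum_i y i) ^+ 2 <= #|I|%:R * \sum_i y i ^+ 2.
Proof.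
have -> : #|I|%:R * \sum_i y i ^+ 2 = \sum_i \sum_j (y i ^+ 2 + y j ^+ 2) / 2.
  rewrite [RHS](eq_bigr (fun i => (y i ^+ 2 *+ #|I| + \sum_j y j ^+ 2) / 2)).
    rewrite -mulr_suml big_split/= sumr_const sumrMnl -[X in X / _]mulr2n.
    rewrite -[X in X / _]mulr_natr mulfK//.
    by rewrite mulr_natl.
  by move=> i _; rewrite -mulr_suml big_split/= sumr_const.
rewrite expr2 big_distrlr/=; apply: ler_sum => i _; apply: ler_sum => j _.
by have := sqr_ge0 (y i - y j); nra.
Qed.

Lemma prod_expr_count (R : comPzRingType) (J : finType) (F : J -> R)
    (r : seq J) :
  \prod_(q <- r) F q = \prod_j F j ^+ count_mem j r.
Proof.
elim: r => [|q r ih]; first by rewrite big_nil big1.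
rewrite big_cons ih (bigD1 q)//= [RHS](bigD1 q)//= eqxx exprS mulrA.
by congr (_ * _); apply: eq_bigr => j; rewrite eq_sym => /negbTE ->.
Qed.

(* The contraction of a closed chain of [n] three-leg tensors: [s l] is the
   physical index of the site [l], and [a l] the index of the bond joining
   [ord_pred l] to [l]. *)
Section CyclicContraction.
Variables (R : comNzRingType) (n : nat).

Definition cyclic_contraction (S X : 'I_n -> finType)
    (f : forall l, S l -> X l -> X (ordS l) -> R) : R :=
  \sum_(s : {dffun forall l, S l}) \sum_(a : {dffun forall l, X l})
    \prod_l f l (s l) (a l) (a (ordS l)).

Lemma eq_cyclic_contraction (S X : 'I_n -> finType)
    (f g : forall l, S l -> X l -> X (ordS l) -> R) :
  (forall l s a b, f l s a b = g l s a b) ->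
  cyclic_contraction f = cyclic_contraction g.
Proof. by move=> fg; do 3!apply: eq_bigr => ? _; exact: fg. Qed.

Lemma cyclic_contractionM (S X S' X' : 'I_n -> finType)
    (f : forall l, S l -> X l -> X (ordS l) -> R)
    (g : forall l, S' l -> X' l -> X' (ordS l) -> R) :
  cyclic_contraction f * cyclic_contraction g =
  cyclic_contraction (S := fun l => (S l * S' l)%type)
                     (X := fun l => (X l * X' l)%type)
    (fun l s a b => f l s.1 a.1 b.1 * g l s.2 a.2 b.2).
Proof.
rewrite /cyclic_contraction big_distrlr/= pair_big_dffun; apply: eq_bigr => s _.
rewrite big_distrlr/= pair_big_dffun; apply: eq_bigr => a _.
by rewrite -big_split/=; apply: eq_bigr => l _; rewrite !ffunE.
Qed.

Definition at_site (S X : 'I_n -> finType) (k : 'I_n)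
    (f g : forall l, S l -> X l -> X (ordS l) -> R) l (s : S l) (a : X l)
    (b : X (ordS l)) : R :=
  if l == k then f l s a b else g l s a b.

Lemma cyclic_contraction_at_site (S X : 'I_n -> finType) k
    (f g : forall l, S l -> X l -> X (ordS l) -> R) :
  cyclic_contraction (at_site k f g) =
  \sum_(s : {dffun forall l, S l}) \sum_(a : {dffun forall l, X l})
    f k (s k) (a k) (a (ordS k)) *
    \prod_(l | l != k) g l (s l) (a l) (a (ordS l)).
Proof.
apply: eq_bigr => s _; apply: eq_bigr => a _.
rewrite (bigD1 k)//= /at_site eqxx; congr (_ * _).
by apply: eq_bigr => l /negbTE ->.
Qed.

Lemma cyclic_contraction_sum_site (S X : 'I_n -> finType) k (J : finType)
    (f : J -> forall l, S l -> X l -> X (ordS l) -> R)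
    (g : forall l, S l -> X l -> X (ordS l) -> R) :
  \sum_j cyclic_contraction (at_site k (f j) g) =
  cyclic_contraction (at_site k (fun l s a b => \sum_j f j l s a b) g).
Proof.
under eq_bigr do rewrite cyclic_contraction_at_site.
rewrite cyclic_contraction_at_site exchange_big; apply: eq_bigr => s _.
rewrite exchange_big; apply: eq_bigr => a _.
by rewrite mulr_suml.
Qed.

Lemma cyclic_contraction_linear_site (S X : 'I_n -> finType) k t
    (f0 f1 g : forall l, S l -> X l -> X (ordS l) -> R) :
  cyclic_contraction
    (at_site k (fun l s a b => f0 l s a b + t * f1 l s a b) g) =
  cyclic_contraction (at_site k f0 g) + t * cyclic_contraction (at_site k f1 g).
Proof.
rewrite !cyclic_contraction_at_site mulr_sumr -big_split; apply: eq_bigr => s _.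
rewrite mulr_sumr -big_split; apply: eq_bigr => a _ /=.
by rewrite mulrDl mulrA.
Qed.

(* When every site tensor is a sum over [p : Pi] of products of one-leg tensors,
   the bond [l] only sees the choices made at the two sites that it joins. *)
Lemma cyclic_contraction_transfer (S X : 'I_n -> finType) (Pi : finType)
    (g : forall l, Pi -> S l -> R) (h : forall l, Pi -> X l -> R) :
  cyclic_contraction (fun l s a b =>
    \sum_(p : Pi) g l p s * h l p a * h (ordS l) p b) =
  \sum_(p : {ffun 'I_n -> Pi}) \prod_l ((\sum_s g l (p l) s) *
     (\sum_a h l (p l) a * h l (p (ord_pred l)) a)).
Proof.
rewrite /cyclic_contraction.
under eq_bigr do under eq_bigr do rewrite bigA_distr_bigA.
under eq_bigr do rewrite exchange_big.
rewrite exchange_big; apply: eq_bigr => p _ /=.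
rewrite big_split/= !bigA_distr_dffun big_distrlr/=.
apply: eq_bigr => s _; apply: eq_bigr => a _.
rewrite !big_split/= mulrA; congr (_ * _).
rewrite [RHS](reindex_inj (can_inj (@ordSK n)))/=.
by apply: eq_bigr => l _; rewrite ordSK.
Qed.

End CyclicContraction.

Lemma ord_pred_invariant_constant (n : nat) (V : Type) (f : 'I_n -> V) :
  (forall l, f l = f (ord_pred l)) -> forall l l', f l = f l'.
Proof.
case: n f => [f _ [] //|n f fE].
suff f0 l : f l = f ord0 by move=> l l'; rewrite !f0.
case: l => m; elim: m => [|m ih] mn; first by congr f; exact: val_inj.
rewrite fE -(ih (ltnW mn)); congr f; apply: val_inj => /=.
by rewrite modnDr modn_small// ltnW.
Qed.

(** * Pairings and Wick's formula *)

Notation copies2 X := (X * X)%type (only parsing).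
Notation copies4 X := (copies2 X * copies2 X)%type (only parsing).

(* The three pairings of the four copies [((q1, q2), (q3, q4))] of an index:
   [None] is 12|34, [Some false] is 13|24 and [Some true] is 14|23. *)
Notation pairing := (option bool).

Section Pairings.
Implicit Types (p : pairing).

Lemma sum_pairing (R : nmodType) (F : pairing -> R) :
  \sum_p F p = F None + (F (Some false) + F (Some true)).
Proof.
rewrite (bigD1 None)//= (bigD1 (Some false))//= (bigD1 (Some true))//=.
by rewrite big1 ?addr0// => -[[]|].
Qed.

Definition paired (X : eqType) p (q : copies4 X) : bool :=
  match p with
  | None => (q.1.1 == q.1.2) && (q.2.1 == q.2.2)
  | Some false => (q.1.1 == q.2.1) && (q.1.2 == q.2.2)
  | Some true => (q.1.1 == q.2.2) && (q.1.2 == q.2.1)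
  end.

Definition zip_copies (X Y : Type) (x : copies4 X) (y : copies4 Y) :
    copies4 (X * Y) :=
  (((x.1.1, y.1.1), (x.1.2, y.1.2)), ((x.2.1, y.2.1), (x.2.2, y.2.2))).

Lemma paired_zip (X Y : eqType) p (x : copies4 X) (y : copies4 Y) :
  paired p (zip_copies x y) = paired p x && paired p y.
Proof. by case: p => [[]|] /=; rewrite !xpair_eqE; exact: andbACA. Qed.

Definition spread (X : Type) p (u : X * X) : copies4 X :=
  match p with
  | None => ((u.1, u.1), (u.2, u.2))
  | Some false => ((u.1, u.2), (u.1, u.2))
  | Some true => ((u.1, u.2), (u.2, u.1))
  end.

Lemma paired_spread (X : eqType) p p' (u : X * X) :
  paired p' (spread p u) = (p == p') || (u.1 == u.2).
Proof.
by case: u => x y; move: p p' => [[]|] [[]|];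
  rewrite /= ?eqxx ?andbb ?orbT//= eq_sym ?andbb.
Qed.

Lemma sum_paired (R : nmodType) (X : finType) p (F : copies4 X -> R) :
  \sum_(q | paired p q) F q = \sum_u F (spread p u).
Proof.
pose gather (q : copies4 X) :=
  if p is None then (q.1.1, q.2.1) else (q.1.1, q.1.2).
rewrite (reindex_onto (spread p) gather) => [|[[q1 q2] [q3 q4]]].
  apply: eq_bigl => -[x y]; rewrite paired_spread eqxx /gather.
  by case: (p) => [[]|] /=; rewrite eqxx.
by rewrite /gather; case: (p) => [[]|] /= /andP[/eqP-> /eqP->].
Qed.

Lemma sum_paired_paired (R : pzSemiRingType) (X : finType) p p' :
  \sum_(q : copies4 X) (paired p q)%:R * (paired p' q)%:R =
  (if p == p' then #|X| ^ 2 else #|X|)%N%:R :> R.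
Proof.
transitivity (\sum_(u : X * X) ((p == p') || (u.1 == u.2))%:R : R).
  under [RHS]eq_bigr do rewrite -paired_spread.
  rewrite -(sum_paired p (fun q => (paired p' q)%:R)) [RHS]big_mkcond.
  by apply: eq_bigr => q _; case: (paired p q); rewrite ?mul1r ?mul0r.
case: (p == p'); first by rewrite sumr_const card_prod mulnn.
under eq_bigr do rewrite -[_%:R]mul1r.
by rewrite (sum_diag (fun=> 1)) sumr_const.
Qed.

End Pairings.

Section WickMoments.
Variables (R : comNzRingType) (J : finType).
Implicit Types (v : R) (q : J) (r : seq J).

(* The expectation of the product of the [X q], [q] in [r], for independent
   centered Gaussian variables [X q] of variance [v]. *)
Definition wick_moment v r : R := \prod_q gauss_moment v (count_mem q r).

Lemma wick_moment_nil v : wick_moment v [::] = 1.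
Proof. exact: big1. Qed.

Lemma wick_moment_cons v q r :
  wick_moment v (q :: r) = v * (count_mem q r)%:R * wick_moment v (rem q r).
Proof.
rewrite /wick_moment (bigD1 q)//= [in RHS](bigD1 q)//= eqxx add1n gauss_momentS.
rewrite count_rem/= eqxx andbT mulrA; congr (_ * _); last first.
  apply: eq_bigr => j jq; rewrite eq_sym (negbTE jq) count_rem/=.
  by rewrite eq_sym (negbTE jq) andbF subn0.
rewrite mulrAC [v * _]mulrC mulrAC; congr (_ * _ * _).
have [qr|qr] := boolP (q \in r); first by rewrite subn1.
by rewrite (count_memPn qr).
Qed.

Lemma wick_moment_pair v q1 q2 :
  wick_moment v [:: q1; q2] = v * (q1 == q2)%:R.
Proof.
rewrite wick_moment_cons/= addn0 eq_sym.
by case: eqVneq => _; rewrite ?wick_moment_nil ?mulr0 ?mul0r ?mulr1.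
Qed.

Lemma wick_moment_quad v (q : copies4 J) :
  wick_moment v [:: q.1.1; q.1.2; q.2.1; q.2.2] =
  \sum_p v ^+ 2 * (paired p q)%:R.
Proof.
case: q => -[q1 q2] [q3 q4]; rewrite wick_moment_cons sum_pairing/=.
rewrite addn0 !natrD ![_ == q1]eq_sym.
have [<-{q2}|q12] := eqVneq q1 q2; last have [<-{q3}|_] := eqVneq q1 q3;
  last have [<-{q4}|_] := eqVneq q1 q4; rewrite ?wick_moment_pair/=.
- have [<-{q3}|q13] := eqVneq q1 q3.
    by case: (q1 == q4); rewrite /=; ring.
  have [<-{q4}|_] := eqVneq q1 q4; last by rewrite /=; ring.
  by rewrite eq_sym (negbTE q13)/=; ring.
- rewrite [q2 == q1]eq_sym (negbTE q12) andbF.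
  have [<-{q4}|_] := eqVneq q1 q4; last by rewrite /=; ring.
  by rewrite eq_sym (negbTE q12)/=; ring.
- by ring.
- by ring.
Qed.

End WickMoments.

(** * The tangent kernel as a glued network *)

Definition site_idx (n : nat) (d D : 'I_n -> nat) (k : 'I_n) : finType :=
  ('I_(d k) * 'I_(D k) * 'I_(D (ordS k)))%type.

Definition site_param (n : nat) (d D : 'I_n -> nat) (k : 'I_n)
  (j : site_idx d D k) : mps_idx d D := Tagged (site_idx d D) j.

Lemma entry_eq_site_param (n : nat) (d D : 'I_n -> nat) (k : 'I_n)
    (s : 'I_(d k)) (a : 'I_(D k)) (b : 'I_(D (ordS k))) (j : site_idx d D k) :
  (entry s a b == site_param j) = ((s, a, b) == j).
Proof. exact: eq_Tagged. Qed.

Lemma big_param (n : nat) (d D : 'I_n -> nat) (V : Type) (idx : V)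
    (op : Monoid.com_law idx) (F : mps_idx d D -> V) :
  \big[op/idx]_i F i =
  \big[op/idx]_(k < n) \big[op/idx]_(j : site_idx d D k) F (site_param j).
Proof. by rewrite [RHS]sig_big_dep/=; apply: eq_bigr => -[]. Qed.

Section NTKContraction.
Variables (R : realType) (n : nat) (d D : 'I_n -> nat).
Variables (phi : forall k : 'I_n, R -> 'I_(d k) -> R) (A : mps_idx d D -> R).
Implicit Types (x : 'I_n -> R) (i : mps_idx d D) (k l : 'I_n).

Definition mps_site x l (s : 'I_(d l)) (a : 'I_(D l))
    (b : 'I_(D (ordS l))) : R :=
  A (entry s a b) * @phi l (x l) s.

Definition delta_site x i l (s : 'I_(d l)) (a : 'I_(D l))
    (b : 'I_(D (ordS l))) : R :=
  (entry s a b == i)%:R * @phi l (x l) s.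

Lemma entry_neq_tag l (s : 'I_(d l)) (a : 'I_(D l)) (b : 'I_(D (ordS l))) i :
  l != tag i -> (entry s a b == i) = false.
Proof. by apply: contraNF => /eqP <-. Qed.

Lemma mps_out_upd x i t : mps_out phi (upd A i t) x =
  cyclic_contraction (at_site (tag i)
    (fun l s a b =>
      upd A i 0 (entry s a b) * @phi l (x l) s + t * delta_site x i s a b)
    (mps_site x)).
Proof.
apply: eq_bigr => s _; apply: eq_bigr => a _; rewrite -big_split/=.
apply: eq_bigr => l _; rewrite /at_site /mps_site /delta_site /upd.
have [_|li] := eqVneq l (tag i); last by rewrite entry_neq_tag.
by case: eqP => _ /=; ring.
Qed.

Lemma dmps_contraction x i : dmps phi A x i =
  cyclic_contraction (at_site (tag i) (delta_site x i) (mps_site x)).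
Proof.
rewrite /dmps.
under eq_fun do rewrite mps_out_upd cyclic_contraction_linear_site.
rewrite derive1E; apply: derive_val; apply: is_derive_eq.
by rewrite /GRing.scale/=; ring.
Qed.

Definition feature2 x x' l (s : copies2 'I_(d l)) : R :=
  @phi l (x l) s.1 * @phi l (x' l) s.2.

Definition glued_site x x' l (s : copies2 'I_(d l)) (a : copies2 'I_(D l))
    (b : copies2 'I_(D (ordS l))) : R :=
  feature2 x x' s * ((s.1, a.1, b.1) == (s.2, a.2, b.2))%:R.

Definition double_site x x' l (s : copies2 'I_(d l)) (a : copies2 'I_(D l))
    (b : copies2 'I_(D (ordS l))) : R :=
  feature2 x x' s * (A (entry s.1 a.1 b.1) * A (entry s.2 a.2 b.2)).

Definition glued_mps x x' k : R :=
  cyclic_contraction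
    (S := fun l => copies2 'I_(d l)) (X := fun l => copies2 'I_(D l))
    (at_site k (glued_site x x') (double_site x x')).

(* Summed over the entries of the site [k], the two deltas identify the indices
   that the two copies of the network carry there. *)
Lemma sum_dmps_site x x' k :
  \sum_(j : site_idx d D k)
    dmps phi A x (site_param j) * dmps phi A x' (site_param j) =
  glued_mps x x' k.
Proof.
under eq_bigr => j _.
  rewrite !dmps_contraction cyclic_contractionM.
  rewrite (@eq_cyclic_contraction _ _ _ _ _ (at_site k
    (fun l s a b => delta_site x (site_param j) s.1 a.1 b.1 *
                    delta_site x' (site_param j) s.2 a.2 b.2)
    (double_site x x'))).
    over.
  move=> l s a b; rewrite /at_site /=; case: eqP => // _.
  by rewrite /mps_site /double_site /feature2; ring.
rewrite cyclic_contraction_sum_site; apply: eq_cyclic_contraction => l s a b.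
rewrite /at_site; case: eqP s a b => [-> s a b|//].
rewrite /delta_site /glued_site (bigD1 (s.2, a.2, b.2))//= big1 => [|j jq].
  by rewrite !entry_eq_site_param eqxx mul1r /feature2; ring.
rewrite !entry_eq_site_param [_ == j in X in _ * X]eq_sym.
by rewrite (negbTE jq) mul0r mulr0.
Qed.

Lemma ntk_glued x x' :
  ntk phi A x x' = \sum_k Defs.eta R D k * glued_mps x x' k.
Proof.
rewrite /ntk big_param; apply: eq_bigr => k _ /=.
rewrite -sum_dmps_site mulr_sumr.
by apply: eq_bigr => j _; rewrite mulrA.
Qed.

End NTKContraction.

(** * Concentration of the kernel *)

Section NTKMoments.
Variables (R : realType) (n : nat) (d D : 'I_n -> nat).
Variables (phi : forall k : 'I_n, R -> 'I_(d k) -> R) (sigma : 'I_n -> R).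
Variables (dT : measure_display) (T : measurableType dT) (P : probability T R).
Variable A : mps_idx d D -> T -> R.
Local Notation eta := (Defs.eta R D).
Local Notation v l := (sigma l ^+ 2 / Num.sqrt (((D l) * (D (ordS l)))%N%:R)).
Hypotheses (D_gt0 : forall l, (0 < D l)%N) (sigma_gt0 : forall l, 0 < sigma l).
Hypothesis indep : mutually_independent P A.
Hypothesis gauss : forall (k : 'I_n) (s : 'I_(d k)) (a : 'I_(D k))
  (b : 'I_(D (ordS k))), centered_gaussian P (A (entry s a b)) (v k).
Variables x x' : 'I_n -> R.
Implicit Types k l : 'I_n.

Local Notation contraction2 f :=
  (cyclic_contraction (S := fun l => copies2 'I_(d l))
                      (X := fun l => copies2 'I_(D l)) f).
Local Notation contraction4 f :=
  (cyclic_contraction (S := fun l => copies4 'I_(d l))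
                      (X := fun l => copies4 'I_(D l)) f).

Let v_gt0 l : 0 < v l.
Proof. by rewrite divr_gt0 ?exprn_gt0// sqrtr_gt0 ltr0n muln_gt0 !D_gt0. Qed.

Lemma expectation_prod_site_words (c : 'I_n -> R)
    (r : forall l, seq (site_idx d D l)) :
  has_expectation P
    (fun w => \prod_l (c l * \prod_(q <- r l) A (site_param q) w))
    (\prod_l (c l * wick_moment (v l) (r l))).
Proof.
pose e (i : mps_idx d D) := count_mem (tagged i) (r (tag i)).
have mA i : measurable_fun setT (A i).
  by case: i => l [[s a] b]; case: (gauss s a b).
have moment_prod : has_expectation P (fun w => \prod_i A i w ^+ e i)
    (\prod_i gauss_moment (v (tag i)) (e i)).
  apply: (expectation_prod mA indep (g := fun i y => y ^+ e i)) => [i|i].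
    exact: measurable_funX.
  by case: i => l [[s a] b]; exact: centered_gaussian_moment (gauss s a b).
apply: has_expectation_eq (has_expectationZ (\prod_l c l) moment_prod) => [w|].
  rewrite [RHS]big_split/= big_param/=; congr (_ * _).
  by apply: eq_bigr => l _; rewrite [RHS]prod_expr_count.
by rewrite [RHS]big_split/= big_param.
Qed.

Lemma expectation_contraction (S X : 'I_n -> finType)
    (f : T -> forall l, S l -> X l -> X (ordS l) -> R)
    (g : forall l, S l -> X l -> X (ordS l) -> R) :
  (forall (s : {dffun forall l, S l}) (a : {dffun forall l, X l}),
    has_expectation P (fun w => \prod_l f w l (s l) (a l) (a (ordS l)))
                      (\prod_l g l (s l) (a l) (a (ordS l)))) ->
  has_expectation P (fun w => cyclic_contraction (f w)) (cyclic_contraction g).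
Proof.
move=> fg; apply: has_expectation_sum => s _.
by apply: has_expectation_sum => a _; exact: fg.
Qed.

Lemma eta_prod : \prod_l (eta l * (D l)%:R) = 1.
Proof.
have etaE l : eta l = (Num.sqrt (D l)%:R)^-1 * (Num.sqrt (D (ordS l))%:R)^-1.
  by rewrite /Defs.eta natrM sqrtrM ?ler0n// invfM.
have shift : \prod_(l < n) (Num.sqrt (D (ordS l))%:R)^-1 =
    \prod_(l < n) (Num.sqrt (D l)%:R)^-1 :> R.
  by rewrite [RHS](reindex_inj (can_inj (@ordSK n))).
under eq_bigr do rewrite etaE.
rewrite 2!big_split/= shift.
rewrite -!big_split/= big1// => l _.
by rewrite -invfM -expr2 sqr_sqrtr ?ler0n// mulVf// pnatr_eq0 -lt0n.
Qed.

Definition site_variance k l : R := if l == k then 1 else v l.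

Definition site_gain k l : R := if l == k then 1 else sigma l ^+ 2.

Lemma eta_prod_site_variance k :
  eta k * \prod_l site_variance k l = \prod_l (eta l * site_gain k l).
Proof.
rewrite (bigD1 k)//= [RHS](bigD1 k)//= /site_variance /site_gain eqxx.
rewrite mul1r mulr1.
by congr (_ * _); apply: eq_bigr => l /negbTE ->; rewrite mulrC.
Qed.

Definition ntk_limit_term k : R :=
  fdot phi k (x k) (x' k) *
  \prod_(l | l != k) (sigma l ^+ 2 * fdot phi l (x l) (x' l)).

Lemma ntk_limit_termE k :
  ntk_limit_term k = \prod_l (site_gain k l * fdot phi l (x l) (x' l)).
Proof.
rewrite /ntk_limit_term [RHS](bigD1 k)//= /site_gain eqxx mul1r.
by congr (_ * _); apply: eq_bigr => l /negbTE ->.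
Qed.

Definition mean_site k l (s : copies2 'I_(d l)) (a : copies2 'I_(D l))
    (b : copies2 'I_(D (ordS l))) : R :=
  site_variance k l * feature2 phi x x' s *
  ((s.1, a.1, b.1) == (s.2, a.2, b.2))%:R.

Lemma expectation_glued_mps k :
  has_expectation P (fun w => glued_mps phi (A^~ w) x x' k)
                    (contraction2 (mean_site k)).
Proof.
apply: expectation_contraction => s a.
pose copy1 l : site_idx d D l := ((s l).1, (a l).1, (a (ordS l)).1).
pose copy2 l : site_idx d D l := ((s l).2, (a l).2, (a (ordS l)).2).
pose c l := feature2 phi x x' (s l) *
  (if l == k then (copy1 l == copy2 l)%:R else 1).
pose r l := if l == k then [::] else [:: copy1 l; copy2 l].
apply: has_expectation_eq (expectation_prod_site_words c r) => [w|];
  apply: eq_bigr => l _; rewrite /c /r.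
  rewrite /at_site /glued_site /double_site; case: eqP => _.
    by rewrite big_nil mulr1.
  by rewrite !big_cons big_nil !mulr1.
rewrite /mean_site /site_variance; case: eqP => _.
  by rewrite wick_moment_nil mulr1 mul1r.
by rewrite wick_moment_pair mulr1 mulrA [_ * v l]mulrC.
Qed.

Lemma mean_contraction k :
  eta k * contraction2 (mean_site k) = ntk_limit_term k.
Proof.
pose phys l (_ : unit) (s : copies2 'I_(d l)) : R :=
  site_variance k l * feature2 phi x x' s * (s.1 == s.2)%:R.
pose bond l (_ : unit) (a : copies2 'I_(D l)) : R := (a.1 == a.2)%:R.
rewrite (@eq_cyclic_contraction _ _ _ _ _ (fun l s a b =>
  \sum_(p : unit) phys l p s * bond l p a * bond (ordS l) p b)); last first.
  move=> l s a b; rewrite (big_pred1 tt) => [|[]//].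
  by rewrite /phys /bond /mean_site !xpair_eqE -!mulnb !natrM !mulrA.
rewrite cyclic_contraction_transfer (big_pred1 [ffun=> tt]) => [|p]; last first.
  by apply/esym/eqP/ffunP => l; rewrite ffunE; case: (p l).
have sum_phys l p :
    \sum_s phys l p s = site_variance k l * fdot phi l (x l) (x' l).
  rewrite /phys (sum_diag (fun s => site_variance k l * feature2 phi x x' s)).
  by rewrite mulr_sumr.
have sum_bond l p p' : \sum_a bond l p a * bond l p' a = (D l)%:R.
  under eq_bigr do rewrite /bond -natrM mulnb andbb -[_%:R]mul1r.
  by rewrite (sum_diag (fun=> 1)) sumr_const card_ord.
under eq_bigr do rewrite sum_phys sum_bond -mulrA.
rewrite big_split/= mulrA eta_prod_site_variance -big_split/= ntk_limit_termE.
rewrite -[RHS]mul1r -[X in _ = X * _]eta_prod -big_split.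
by apply: eq_bigr => l _ /=; ring.
Qed.

Lemma expectation_ntk_term k :
  has_expectation P (fun w => eta k * glued_mps phi (A^~ w) x x' k)
                    (ntk_limit_term k).
Proof.
by rewrite -mean_contraction; exact/has_expectationZ/expectation_glued_mps.
Qed.

Definition feature4 l (s : copies4 'I_(d l)) : R :=
  feature2 phi x x' s.1 * feature2 phi x x' s.2.

(* Gluing each of the two factors at the site [k] forces the pairing 12|34. *)
Definition second_moment_site k l (s : copies4 'I_(d l)) (a : copies4 'I_(D l))
    (b : copies4 'I_(D (ordS l))) : R :=
  \sum_(p : pairing) (site_variance k l ^+ 2 * ((l == k) ==> (p == None))%:R *
    (feature4 s * (paired p s)%:R)) * (paired p a)%:R * (paired p b)%:R.

Lemma expectation_glued_mps_sqr k :
  has_expectation P (fun w => glued_mps phi (A^~ w) x x' k ^+ 2)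
                    (contraction4 (second_moment_site k)).
Proof.
under eq_fun do rewrite expr2 /glued_mps cyclic_contractionM.
apply: expectation_contraction => s a.
pose q l : copies4 (site_idx d D l) :=
  zip_copies (zip_copies (s l) (a l)) (a (ordS l)).
have qE p l : paired p (q l) =
    paired p (s l) && paired p (a l) && paired p (a (ordS l)).
  by rewrite !paired_zip.
pose c l := feature4 (s l) * (if l == k then (paired None (q l))%:R else 1).
pose r l := if l == k then [::]
  else [:: (q l).1.1; (q l).1.2; (q l).2.1; (q l).2.2].
apply: has_expectation_eq (expectation_prod_site_words c r) => [w|];
  apply: eq_bigr => l _; rewrite /c /r /feature4.
  rewrite /at_site /glued_site /double_site; case: eqP => _.
    by rewrite big_nil /= -mulnb natrM; ring.
  by rewrite !big_cons big_nil; rewrite /q /entry /site_param /=; ring.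
rewrite /second_moment_site /site_variance; case: eqP => _.
  by rewrite wick_moment_nil sum_pairing qE -!mulnb !natrM /feature4 /=; ring.
rewrite wick_moment_quad mulr_sumr; apply: eq_bigr => p _.
by rewrite qE -!mulnb !natrM /feature4 /=; ring.
Qed.

Definition pairing_weight k l (p : pairing) : R :=
  site_gain k l ^+ 2 * ((l == k) ==> (p == None))%:R *
  \sum_s @feature4 l s * (paired p s)%:R.

Definition bond_weight l (p p' : pairing) : R :=
  if p == p' then 1 else (D l)%:R^-1.

Lemma second_moment_contraction k :
  eta k ^+ 2 * contraction4 (second_moment_site k) =
  \sum_(p : {ffun 'I_n -> pairing})
    \prod_l (pairing_weight k l (p l) * bond_weight l (p l) (p (ord_pred l))).
Proof.
pose phys l (p : pairing) (s : copies4 'I_(d l)) : R :=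
  site_variance k l ^+ 2 * ((l == k) ==> (p == None))%:R *
  (feature4 s * (paired p s)%:R).
pose bond l (p : pairing) (a : copies4 'I_(D l)) : R := (paired p a)%:R.
rewrite (@eq_cyclic_contraction _ _ _ _ _ (fun l s a b =>
  \sum_(p : pairing) phys l p s * bond l p a * bond (ordS l) p b))//.
rewrite cyclic_contraction_transfer mulr_sumr; apply: eq_bigr => p _.
have sum_bond l p1 p2 :
    \sum_a bond l p1 a * bond l p2 a = (D l)%:R ^+ 2 * bond_weight l p1 p2.
  rewrite sum_paired_paired card_ord /bond_weight; case: eqP => _.
    by rewrite natrX mulr1.
  by rewrite expr2 mulfK// pnatr_eq0 -lt0n.
pose overlap l : R := ((l == k) ==> (p l == None))%:R *
  \sum_s @feature4 l s * (paired (p l) s)%:R.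
rewrite (eq_bigr (fun l => site_variance k l ^+ 2 *
    (overlap l * ((D l)%:R ^+ 2 * bond_weight l (p l) (p (ord_pred l))))));
  last first.
  by move=> l _; rewrite sum_bond /phys -mulr_sumr /overlap !mulrA.
rewrite big_split/= prodrXl mulrA -exprMn eta_prod_site_variance.
rewrite -[RHS]mul1r -[X in _ = X * _](expr1n _ 2).
rewrite -[X in _ = X ^+ 2 * _]eta_prod -!prodrXl -!big_split.
by apply: eq_bigr => l _; rewrite /pairing_weight /overlap/=; ring.
Qed.

Lemma prod_pairing_weight_None k :
  \prod_l pairing_weight k l None = ntk_limit_term k ^+ 2.
Proof.
rewrite ntk_limit_termE -prodrXl; apply: eq_bigr => l _.
rewrite /pairing_weight eqxx implybT mulr1 exprMn; congr (_ * _).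
transitivity (\sum_(s | paired None s) @feature4 l s).
  rewrite [RHS]big_mkcond; apply: eq_bigr => s _.
  by case: (paired _ _); rewrite ?mulr1 ?mulr0.
by rewrite sum_paired -(pair_bigA _ (fun y z => feature4 (spread None (y, z))))
  expr2 big_distrlr.
Qed.

(* A non-constant assignment breaks some bond [l], which costs [1 / D l], and a
   constant one other than [None] is ruled out at the site [k]. *)
Lemma pairing_term_le k (p : {ffun 'I_n -> pairing}) : p != [ffun=> None] ->
  \prod_l (pairing_weight k l (p l) * bond_weight l (p l) (p (ord_pred l))) <=
  (\prod_l `|pairing_weight k l (p l)|) * \sum_l (D l)%:R^-1.
Proof.
move=> p_neq.
have bond_ge0 l : 0 <= bond_weight l (p l) (p (ord_pred l)).
  by rewrite /bond_weight; case: ifP.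
have [/forallP p_const|/forallPn[l0 p_l0]] :=
    boolP [forall l, p l == p (ord_pred l)].
  have pk : p k != None.
    apply: contra p_neq => /eqP pk; apply/eqP/ffunP => l; rewrite ffunE -pk.
    by apply: ord_pred_invariant_constant => l'; exact/eqP/p_const.
  rewrite (bigD1 k)//= {1}/pairing_weight eqxx (negbTE pk) mulr0 !mul0r.
  by rewrite mulr_ge0 ?prodr_ge0// sumr_ge0.
apply: (le_trans (ler_norm _)); rewrite normr_prod.
under eq_bigr => l _ do rewrite normrM (ger0_norm (bond_ge0 l)).
rewrite big_split/= ler_wpM2l ?prodr_ge0//.
rewrite (bigD1 l0)//= {1}/bond_weight (negbTE p_l0) [leRHS](bigD1 l0)//=.
apply: (@le_trans _ _ (D l0)%:R^-1); last by rewrite lerDl sumr_ge0.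
rewrite ler_piMr// prodr_ile1// => l _; rewrite bond_ge0/= /bond_weight.
by case: ifP => // _; rewrite invf_le1 ?ler1n ?ltr0n.
Qed.

Definition variance_constant k : R :=
  \sum_(p : {ffun 'I_n -> pairing}) \prod_l `|pairing_weight k l (p l)|.

Lemma ntk_term_variance_le k : exists2 V,
  has_expectation P
    (fun w => (eta k * glued_mps phi (A^~ w) x x' k - ntk_limit_term k) ^+ 2)
    V &
  V <= variance_constant k * \sum_l (D l)%:R^-1.
Proof.
pose L := ntk_limit_term k.
exists (\sum_(p : {ffun 'I_n -> pairing} | p != [ffun=> None])
  \prod_l (pairing_weight k l (p l) * bond_weight l (p l) (p (ord_pred l)))).
  have second := has_expectationZ (eta k ^+ 2) (expectation_glued_mps_sqr k).
  rewrite second_moment_contraction (bigD1 [ffun=> None])//= in second.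
  apply: has_expectation_eq (has_expectationD second (has_expectationD
    (has_expectationZ (- (2 * L)) (expectation_ntk_term k))
    (has_expectation_cst P (L ^+ 2)))) => [w|]; first by rewrite /L /=; ring.
  rewrite (eq_bigr (fun l => pairing_weight k l None)) => [|l _]; last first.
    by rewrite !ffunE /bond_weight eqxx mulr1.
  by rewrite prod_pairing_weight_None -/L; ring.
rewrite /variance_constant mulr_suml [leRHS](bigD1 [ffun=> None])//=.
rewrite -[leLHS]add0r lerD//.
  by rewrite mulr_ge0 ?prodr_ge0// sumr_ge0.
by apply: ler_sum => p; exact: pairing_term_le.
Qed.

Lemma ntk_tail_bound eps : 0 < eps ->
  fine (P [set w | eps < `|ntk phi (A^~ w) x x' - ntk_limit phi sigma x x'|]) <=
  eps ^- 2 * (n%:R * \sum_k variance_constant k) * \sum_l (D l)%:R^-1.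
Proof.
move=> eps_gt0.
pose Z k w := eta k * glued_mps phi (A^~ w) x x' k - ntk_limit_term k.
have /choice[V VP] : forall k, exists V,
    has_expectation P (fun w => Z k w ^+ 2) V /\
    V <= variance_constant k * \sum_l (D l)%:R^-1.
  by move=> k; have [V ZV VC] := ntk_term_variance_le k; exists V.
have ntkE w : ntk phi (A^~ w) x x' - ntk_limit phi sigma x x' = \sum_k Z k w.
  by rewrite ntk_glued sumrB.
have sumV := has_expectationZ n%:R
  (has_expectation_sum (index_enum 'I_n) (Q := xpredT) (fun k _ => (VP k).1)).
apply: (le_trans (second_moment_tail_bound _ _ sumV eps_gt0)).
- under eq_fun do rewrite ntkE; apply: measurable_sum => k.
  apply: measurable_funB => //.
  exact: has_expectation_measurable (expectation_ntk_term k).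
- by move=> w; rewrite ntkE -[n in n%:R]card_ord; exact: sqr_sum_le.
have eps2_ge0 : 0 <= eps ^- 2 by rewrite invr_ge0 exprn_ge0// ltW.
rewrite -!mulrA ler_wpM2l// ler_wpM2l//.
by rewrite mulr_suml; apply: ler_sum => k _; exact: (VP k).2.
Qed.

End NTKMoments.

Section MeasurableNTK.
Variables (R : realType) (n : nat) (d D : 'I_n -> nat).
Variables (phi : forall k : 'I_n, R -> 'I_(d k) -> R).
Variables (dT : measure_display) (T : measurableType dT).

Lemma measurable_cyclic_contraction (S X : 'I_n -> finType)
    (f : T -> forall l, S l -> X l -> X (ordS l) -> R) :
  (forall l s a b, measurable_fun setT (fun w => f w l s a b)) ->
  measurable_fun setT (fun w => cyclic_contraction (f w)).
Proof.
move=> mf; apply: measurable_sum => s; apply: measurable_sum => a.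
by apply: measurable_prod => l _; exact: mf.
Qed.

Lemma measurable_ntk (A : mps_idx d D -> T -> R) x x' :
  (forall i, measurable_fun setT (A i)) ->
  measurable_fun setT (fun w => ntk phi (A^~ w) x x').
Proof.
move=> mA; under eq_fun do rewrite ntk_glued.
apply: measurable_sum => k; apply: measurable_funM => //.
apply: measurable_cyclic_contraction => l s a b.
rewrite /at_site; case: eqP => _ //; apply: measurable_funM => //.
exact: measurable_funM.
Qed.

End MeasurableNTK.

(** * Sequential upper limits *)

Section SequentialLimsup.
Variable R : realType.
Implicit Types (u v : nat -> R) (c : R).

Lemma limn_sup_ge u c : bounded_fun (u : nat -> R^o) ->
  (forall N, c <= u N) -> c <= limn_sup u.
Proof.
move=> bu cu; rewrite limn_supE//.
apply: lb_le_inf; first by exists (sups u 0); exists 0%N.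
move=> _ [N _ <-]; apply: (le_trans (cu N)); apply: ub_le_sup.
  exact/has_ubound_sdrop/bounded_fun_has_ubound.
by exists N => /=.
Qed.

Lemma limn_sup_le_cvg u v c : bounded_fun (u : nat -> R^o) ->
  (\forall N \near \oo, u N <= v N) -> v @ \oo --> c -> limn_sup u <= c.
Proof.
move=> bu uv vc; rewrite limn_supE//; apply/ler_addgt0Pr => e e_gt0.
have [k _ uN] : \forall N \near \oo, u N <= c + e.
  near=> N; apply: (@le_trans _ _ (v N)); first by near: N.
  rewrite addrC -lerBlDr; apply: le_trans (ler_norm _) _.
  by near: N; exact: cvgr_distC_le.
apply: (@le_trans _ _ (sups u k)).
  by apply: ge_inf; [exact: bounded_fun_has_lbound_sups|exists k].
apply: ge_sup; first by exists (u k); exists k => /=.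
by move=> _ [m /= km <-]; exact: uN.
Unshelve. all: by end_near. Qed.

Lemma seq_limsup_eq0 n (s : seq 'I_n) (f : ('I_n -> nat) -> R) M C :
  uniq s -> (forall D, 0 <= f D <= M) ->
  (forall D, (forall l, l \in s -> (0 < D l)%N) ->
     f D <= C * \sum_(l <- s) (D l)%:R^-1) ->
  forall D0, seq_limsup s f D0 = 0.
Proof.
elim: s f => [|l s ih] f /= => [_ fM fC D0|/andP[ls us] fM fC].
  apply/le_anti; have /andP[-> _] := fM D0.
  by have := fC D0; rewrite big_nil mulr0 andbT; exact.
have bounded_f D : bounded_fun ((fun N => f (setdim D l N)) : nat -> R^o).
  exists M; split; first exact: num_real.
  move=> M' MM' N _ /=; have /andP[f_ge0 f_le] := fM (setdim D l N).
  by rewrite ger0_norm// (le_trans f_le)// ltW.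
apply: ih => // D.
  apply/andP; split.
    by apply: limn_sup_ge => // N; have /andP[] := fM (setdim D l N).
  apply: limn_sup_le_cvg (cvg_cst M) => //.
  by apply: nearW => N; have /andP[] := fM (setdim D l N).
move=> D_gt0.
have restE N : \sum_(j <- s) (setdim D l N j)%:R^-1 =
    \sum_(j <- s) (D j)%:R^-1 :> R.
  rewrite big_seq [RHS]big_seq; apply: eq_bigr => j js; rewrite /setdim.
  by case: eqP => // jl; rewrite -jl js in ls.
pose bound N := C * (N%:R^-1 + \sum_(j <- s) (D j)%:R^-1).
apply: (@limn_sup_le_cvg _ bound) => //.
  near=> N; apply: le_trans (fC _ _) _ => [j|].
    rewrite inE /setdim; case: eqP => [_ _|_ /= /D_gt0//].
    by near: N; exact: nbhs_infty_gt.
  by rewrite big_cons {1}/setdim eqxx restE.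
rewrite -[X in _ --> C * X]add0r; apply: cvgMl_tmp.
apply: cvgD; last exact: cvg_cst.
by rewrite -cvg_shiftS; exact: cvg_harmonic.
Unshelve. all: by end_near. Qed.

End SequentialLimsup.

Unset Implicit Arguments.

Theorem theorem2 (R : realType) (n : nat) (hn : (0 < n)%N) (d : 'I_n -> nat)
  (phi : forall k : 'I_n, R -> 'I_(d k) -> R) (sigma : 'I_n -> R)
  (hsigma : forall k, 0 < sigma k)
  (dT : measure_display) (T : measurableType dT) (P : probability T R)
  (A : forall D : 'I_n -> nat, mps_idx d D -> T -> R)
  (hindep : forall D, mutually_independent P (A D))
  (hgauss : forall D (k : 'I_n) (s : 'I_(d k)) (a : 'I_(D k)) (b : 'I_(D (ordS k))),
     centered_gaussian P (A D (entry s a b))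
       (sigma k ^+ 2 / Num.sqrt (((D k) * (D (ordS k)))%N%:R)))
  (xi xj : 'I_n -> R)
  (order : {perm 'I_n}) :
  forall eps : R, 0 < eps ->
  forall D0 : 'I_n -> nat,
    seq_limsup [seq order l | l <- enum 'I_n]
      (fun D => fine (P [set w | eps < `| ntk phi (fun i => A D i w) xi xj
                                           - ntk_limit phi sigma xi xj | ]))
      D0 = 0.
Proof.
move=> eps eps_gt0; apply: seq_limsup_eq0 => [|D|D].
- by rewrite map_inj_uniq ?enum_uniq//; exact: perm_inj.
- apply/fine_probability_itv01/measurable_tail/measurable_funB => //.
  by apply: measurable_ntk => -[l [[s a] b]]; case: (hgauss D l s a b).
have <- : \sum_l (D l)%:R^-1 =
    \sum_(l <- [seq order l | l <- enum 'I_n]) (D l)%:R^-1 :> R.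
  by rewrite big_map big_enum/= [LHS](reindex_perm order).
move=> D_gt0.
apply: ntk_tail_bound => // l; apply: D_gt0; apply/mapP.
by exists ((order^-1)%g l); rewrite ?mem_enum ?permKV.
Qed.
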